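(* Let $K$ be a complex cubic number field, $n \in \mathbb{Z}$, and $\varepsilon, \delta \in \mathcal{O}_K^\times$ with $\varepsilon + \delta = n$. Then exactly one of the following three cases holds: (1) either $n = 0$, or $(\varepsilon,\delta) = (1,1)$, or $(\varepsilon,\delta) = (-1,-1)$; (2) $K = L_a$ for some nonzero integer $a \geq -1$, $n = \pm a$, and either $(\varepsilon,\delta) = (\pm\sigma(\omega_a), \pm\sigma(-\omega_a + a))$ or $(\varepsilon,\delta) = (\pm\sigma(-\omega_a+a), \pm\sigma(\omega_a))$ for some $\sigma \in \mathrm{Gal}(K/\mathbb{Q})$; (3) $K$ is one of $L_{-1}$, $L_1$, or $\mathbb{Q}[x]/(x^3-x^2-x-1)$, and $(\varepsilon,\delta)$ is equivalent to one of the following $14$ sporadic solutions (listed as $(\varepsilon,\delta; n)$, with $\omega$ a root of the indicated polynomial): In $L_{-1}$, $\omega$ a root of $x^3+x^2-1$: $(\omega, -\omega+1; 1)$, $(\omega^2, -\omega^2+1; 1)$, $(\omega^2+\omega, -\omega^2-\omega+1; 1)$, $(-\omega^2-\omega, \omega^2+\omega+1; 1)$, $(\omega^2+2\omega+2, -\omega^2-2\omega-1; 1)$, $(\omega+1, -\omega+1; 2)$, $(\omega^2+\omega+1, -\omega^2-\omega+1; 2)$, $(\omega^2+2\omega+1, -\omega^2-2\omega+2; 3)$, $(\omega^2+2\omega+2, -\omega^2-2\omega+2; 4)$. In $L_1$, $\omega$ a root of $x^3-x^2-1$: $(-\omega^2, \omega^2+1; 1)$, $(\omega^2-\omega, -\omega^2+\omega+1;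 1)$, $(\omega^2, -\omega^2+2; 2)$, $(\omega^2+1, -\omega^2+2; 3)$. In $\mathbb{Q}[x]/(x^3-x^2-x-1)$, $\omega$ a root of $x^3-x^2-x-1$: $(\omega, -\omega+2; 2)$.
   Context: A cubic field is complex if it has signature $(1,1)$, equivalently negative discriminant. For a nonzero integer $a \geq -1$, $\omega_a$ denotes a root of $g_a(x) = x^3 - ax^2 - 1$ and $L_a = \mathbb{Q}(\omega_a)$; field equalities are up to isomorphism. Two solutions $(\varepsilon_1,\delta_1)$, $(\varepsilon_2,\delta_2)$ of $\varepsilon+\delta=n$ are called equivalent if $(\varepsilon_1,\delta_1) = (\pm\sigma(\varepsilon_2), \pm\sigma(\delta_2))$ or $(\varepsilon_1,\delta_1) = (\pm\sigma(\delta_2), \pm\sigma(\varepsilon_2))$ for some $\sigma \in \mathrm{Gal}(K/\mathbb{Q})$. *)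

(* Defs.v *)
From HB Require Import structures.
From mathcomp Require Import all_boot all_order all_algebra all_field.
From mathcomp Require Import ring.

Set Implicit Arguments.
Unset Strict Implicit.
Unset Printing Implicit Defensive.

Import Order.TTheory GRing.Theory Num.Theory.
Local Open Scope ring_scope.

Section NumberField.

Variable K : fieldExtType rat.

(* The image of a number field in the complex numbers is algebraic, so the
   complex embeddings of K are its embeddings into algC. *)
Definition real_embedding (f : {rmorphism K -> algC}) : Prop :=
  forall x, f x \is Num.real.

Definition conj_embedding (f g : {rmorphism K -> algC}) : Prop :=
  forall x, f x = (g x)^*.

(* The embeddings of K are exactly the r1 pairwise distinct real embeddings
   [rho i], and the r2 pairwise distinct pairs of conjugate non-real embeddings
   represented by the [tau j]. *)
Definition has_signature (r1 r2 : nat) : Prop :=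
  exists (rho : 'I_r1 -> {rmorphism K -> algC})
         (tau : 'I_r2 -> {rmorphism K -> algC}),
    [/\ (forall i, real_embedding (rho i)) /\
        (forall j, ~ real_embedding (tau j)),
        forall i i', rho i =1 rho i' -> i = i',
        forall j j', tau j =1 tau j' \/ conj_embedding (tau j) (tau j') ->
                     j = j'
      & forall f : {rmorphism K -> algC},
          (exists i, f =1 rho i) \/
          (exists j, f =1 tau j \/ conj_embedding f (tau j))].

Definition complex_cubic : Prop := \dim {:K} = 3 /\ has_signature 1 1.

Definition in_OK (x : K) : Prop := integralOver (intr : int -> K) x.

Definition OK_unit (x : K) : Prop :=
  in_OK x /\ exists2 y, in_OK y & x * y = 1.

(* [gal_of] is only available for normal extensions, which complex cubic fields
   are not; [kAut 1 {:K}] is the underlying predicate of automorphisms of K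
   over the prime field. *)
Definition in_Gal (s : 'End(K)) : Prop := kAut 1 {:K} s.

(* A displayed pair (± x, ± y) carries the same sign in both components. *)
Definition equivalent (p q : K * K) : Prop :=
  exists (b : bool) (s : 'End(K)), in_Gal s /\
    (p = ((-1) ^+ b * s q.1, (-1) ^+ b * s q.2) \/
     p = ((-1) ^+ b * s q.2, (-1) ^+ b * s q.1)).

Definition g (a : int) : {poly K} := 'X^3 - a%:~R *: 'X^2 - 1.

(* K = L_a, up to an isomorphism under which omega_a corresponds to w. *)
Definition is_L (a : int) (w : K) : Prop :=
  root (g a) w /\ <<1; w>>%VS = {:K}%VS.

Definition tribonacci_poly : {poly rat} := 'X^3 - 'X^2 - 'X - 1.

(* K = Q[x]/(x^3 - x^2 - x - 1), up to an isomorphism under which the class of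
   x corresponds to w. *)
Definition is_tribonacci_field (w : K) : Prop :=
  exists phi : {rmorphism {poly %/ tribonacci_poly} -> K},
    bijective phi /\ w = phi 'qX.

(* The third component of each triple is the integer n = eps + delta
   (see [sporadic_sums]); equivalence only concerns the first two. *)
Definition sporadic_Lm1 (w : K) : seq (K * K * int) :=
  [:: (w, - w + 1, 1);
      (w ^+ 2, - w ^+ 2 + 1, 1);
      (w ^+ 2 + w, - w ^+ 2 - w + 1, 1);
      (- w ^+ 2 - w, w ^+ 2 + w + 1, 1);
      (w ^+ 2 + 2 * w + 2, - w ^+ 2 - 2 * w - 1, 1);
      (w + 1, - w + 1, 2);
      (w ^+ 2 + w + 1, - w ^+ 2 - w + 1, 2);
      (w ^+ 2 + 2 * w + 1, - w ^+ 2 - 2 * w + 2, 3);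
      (w ^+ 2 + 2 * w + 2, - w ^+ 2 - 2 * w + 2, 4)].

Definition sporadic_L1 (w : K) : seq (K * K * int) :=
  [:: (- w ^+ 2, w ^+ 2 + 1, 1);
      (w ^+ 2 - w, - w ^+ 2 + w + 1, 1);
      (w ^+ 2, - w ^+ 2 + 2, 2);
      (w ^+ 2 + 1, - w ^+ 2 + 2, 3)].

Definition sporadic_tribonacci (w : K) : seq (K * K * int) :=
  [:: (w, - w + 2, 2)].

Fact sporadic_sums (w : K) (t : K * K * int) :
  t \in sporadic_Lm1 w ++ sporadic_L1 w ++ sporadic_tribonacci w ->
  t.1.1 + t.1.2 = t.2%:~R.
Proof.
rewrite !inE => H; repeat (case/orP: H => [/eqP-> /=|H]; first ring).
by move/eqP: H => -> /=; ring.
Qed.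

Definition case1 (n : int) (eps del : K) : Prop :=
  [\/ n = 0, (eps, del) = (1, 1) | (eps, del) = (-1, -1)].

Definition case2 (n : int) (eps del : K) : Prop :=
  exists (a : int) (w : K),
    [/\ a <> 0, -1 <= a, is_L a w, n = a \/ n = - a
      & exists (b : bool) (s : 'End(K)), in_Gal s /\
          ((eps, del) = ((-1) ^+ b * s w, (-1) ^+ b * s (- w + a%:~R)) \/
           (eps, del) = ((-1) ^+ b * s (- w + a%:~R), (-1) ^+ b * s w))].

Definition case3 (eps del : K) : Prop :=
  exists w : K,
    [\/ is_L (-1) w /\
          (exists2 t, t \in sporadic_Lm1 w & equivalent (eps, del) t.1),
        is_L 1 w /\
          (exists2 t, t \in sporadic_L1 w & equivalent (eps, del) t.1)
      | is_tribonacci_field w /\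
          (exists2 t, t \in sporadic_tribonacci w
                    & equivalent (eps, del) t.1)].

End NumberField.

Definition exactly_one (P Q R : Prop) : Prop :=
  [\/ [/\ P, ~ Q & ~ R], [/\ ~ P, Q & ~ R] | [/\ ~ P, ~ Q & R]].

(* Main.v *)
From HB Require Import structures.
Require Import Defs.
From mathcomp Require Import all_boot all_order all_algebra all_field.
From mathcomp Require Import ring zify.

(* If eps is irrational, it is a root of a monic integral cubic f, and the norms
   of eps and del give f(0) = 1 or -1 and f(n) = 1 or -1. As f has one real root r
   and a pair of complex conjugate roots, f has the sign of x - r on the reals: it
   cannot be nonnegative somewhere and nonpositive further right. Up to the
   substitutions (eps, del) -> (- eps, - del) and (eps, del) -> (del, eps) we may
   assume n > 0 and f(0) = -1; testing signs at a few half-integers then leaves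
   the family x^2 (x - n) - 1 and finitely many cubics, for each of which omega is
   an explicit polynomial in eps.

   The three cases exclude each other because eps + del = 0 or eps = del in case
   (1), while eps^2 del or eps del^2 is 1 or -1 in case (2), and the linear
   independence of 1, omega, omega^2 refutes these equations in the other
   cases. *)

Set Implicit Arguments.
Unset Strict Implicit.
Unset Printing Implicit Defensive.

Import Order.TTheory GRing.Theory Num.Theory.
Local Open Scope ring_scope.

(** * Irrational elements of a cubic field *)

Section CubicExtension.

Variable K : fieldExtType rat.
Hypothesis dimK : \dim {:K} = 3.

(** The degree divides the prime 3 and differs from 1. *)
Lemma adjoin_degree_cubic (x : K) : x \notin 1%VS -> adjoin_degree 1%AS x = 3.
Proof.
rewrite -adjoin_deg_eq1 => deg_neq1.
have /field_dimS : (<<1; x>> <= {:K})%VS by rewrite subvf.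
rewrite dim_Fadjoin dimv1 muln1 dimK => deg_dvd3.
have [_ /(_ _ deg_dvd3)] := @primeP 3 isT.
by rewrite /= (negbTE deg_neq1) => /eqP.
Qed.

Lemma adjoin_cubic (x : K) : x \notin 1%VS -> <<1; x>>%VS = {:K}%VS.
Proof.
move=> xN1; apply/eqP; rewrite eqEdim subvf dimK dim_Fadjoin.
by rewrite adjoin_degree_cubic ?dimv1.
Qed.

(** The minimal polynomial of an irrational x has degree 3 and divides p, so p cannot be nonzero of
    smaller degree. *)
Lemma cubic_free_poly (x : K) (p : {poly rat}) : x \notin 1%VS ->
  (size p <= 3)%N -> (map_poly (in_alg K) p).[x] = 0 -> p = 0.
Proof.
move=> xN1 sp px0; apply/eqP; apply: contraLR sp => p0; rewrite -ltnNge.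
have : minPoly 1%AS x %| map_poly (in_alg K) p.
  by apply: minPoly_dvdp; [apply/polyOver1P; exists p | apply/eqP].
move/dvdp_leq; rewrite map_poly_eq0 size_map_poly size_minPoly.
by rewrite adjoin_degree_cubic //; apply.
Qed.

Lemma cubic_free_int (x : K) (a b c : int) : x \notin 1%VS ->
  a%:~R * x ^+ 2 + b%:~R * x + c%:~R = 0 -> [/\ a = 0, b = 0 & c = 0].
Proof.
move=> xN1 e.
have /polyP p0 : Poly [:: c%:~R; b%:~R; a%:~R] = 0 :> {poly rat}.
  apply: (cubic_free_poly xN1); first exact: leq_trans (size_Poly _) _.
  rewrite map_Poly ?rmorph0 //= !cons_poly_def mul0r add0r.
  rewrite !hornerE /= !alg_num_field !ratr_int -[RHS]e; ring.
move: (p0 0) (p0 1) (p0 2); rewrite !coef_Poly !coef0 /=.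
by move=> /eqP + /eqP + /eqP; rewrite !intr_eq0 => /eqP-> /eqP-> /eqP->.
Qed.

Lemma cubic_root_rat (x : K) : x \notin 1%VS ->
  exists a b c : rat, x ^+ 3 + ratr a * x ^+ 2 + ratr b * x + ratr c = 0.
Proof.
move=> xN1; have /polyOver1P[p Dp] := minPolyOver 1%AS x.
have sp : size p = 4.
  by rewrite -(size_map_poly (in_alg K)) -Dp size_minPoly adjoin_degree_cubic.
have p3 : p`_3 = 1.
  have := monic_minPoly 1%AS x; rewrite Dp map_monic => /monicP.
  by rewrite lead_coefE sp.
exists p`_2, p`_1, p`_0.
have := minPolyxx 1%AS x; rewrite Dp horner_coef size_map_poly sp.
rewrite !big_ord_recr big_ord0 /= !coef_map /= p3 scale1r !alg_num_field => <-.
ring.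
Qed.

(** As x generates K, every f y is a rational polynomial in f x. Hence a non-real embedding takes
    non-real values at all irrational elements. *)
Lemma morph_real (f : {rmorphism K -> algC}) (x : K) : x \notin 1%VS ->
  f x \is Num.real -> real_embedding f.
Proof.
move=> xN1 fxR y; have : y \in <<1%AS; x>>%VS by rewrite adjoin_cubic ?memvf.
move/Fadjoin_poly_eq => <-.
have /polyOver1P[p ->] := Fadjoin_polyOver 1%AS x y.
rewrite horner_coef rmorph_sum rpred_sum // => i _.
rewrite coef_map /= alg_num_field rmorphM rmorphXn /= fmorph_rat.
by rewrite rpredM ?rpredX // Creal_Crat ?Crat_rat.
Qed.

End CubicExtension.

(** * Cubics with a single real root *)

Definition cubic (R : nzRingType) (a b c x : R) : R :=
  x ^+ 3 + a * x ^+ 2 + b * x + c.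

Lemma cubic_morph (R S : nzRingType) (f : {rmorphism R -> S}) a b c x :
  f (cubic a b c x) = cubic (f a) (f b) (f c) (f x).
Proof. by rewrite /cubic !(rmorphD, rmorphM, rmorphXn). Qed.

(** Subtracting the two root equations and cancelling z - u determines b, then c; the third root
    comes from the sum of the roots, which is - a. *)
Lemma cubic_vieta (F : fieldType) (a b c z u : F) : z != u ->
    cubic a b c z = 0 -> cubic a b c u = 0 ->
  forall x, cubic a b c x = (x - (- a - z - u)) * (x - z) * (x - u).
Proof.
rewrite -subr_eq0 => zu fz fu x.
have b_eq : b = - (z ^+ 2 + z * u + u ^+ 2 + a * (z + u)).
  apply/eqP; rewrite -subr_eq0 opprK -(mulrI_eq0 _ (mulfI zu)); apply/eqP.
  transitivity (cubic a b c z - cubic a b c u); last by rewrite fz fu subrr.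
  rewrite /cubic; ring.
have c_eq : c = - (z ^+ 3 + a * z ^+ 2 + b * z).
  by apply/eqP; rewrite -subr_eq0 opprK addrC -/(cubic a b c z) fz.
rewrite /cubic c_eq b_eq; ring.
Qed.

Section RealCubic.

Variables a b c z : algC.
Hypotheses (aR : a \is Num.real) (bR : b \is Num.real) (cR : c \is Num.real).
Hypotheses (zNR : z \isn't Num.real) (fz : cubic a b c z = 0).

(** The conjugate of z is a second root, distinct from z because z is not real. *)
Lemma real_cubic_factor :
  forall x, cubic a b c x = (x - (- a - z - z^*)) * (x - z) * (x - z^*).
Proof.
apply: cubic_vieta => //; first by rewrite eq_sym -CrealE.
have := congr1 (fun x => x^*) fz.
rewrite cubic_morph rmorph0 /=.
by rewrite (conj_Creal aR) (conj_Creal bR) (conj_Creal cR).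
Qed.

(* The cubic is (x - r) |x - z|^2 at real x, hence has the sign of x - r. *)
Lemma real_cubic_sign p q : p \is Num.real -> q \is Num.real -> p < q ->
  0 <= cubic a b c p -> 0 < cubic a b c q.
Proof.
move=> pR qR p_lt_q; rewrite !real_cubic_factor -!mulrA.
have norm_gt0 x : x \is Num.real -> 0 < (x - z) * (x - z^*).
  move=> xR; rewrite -{2}(conj_Creal xR) -rmorphB -normCK exprn_gt0 //.
  by rewrite normr_gt0 subr_eq0; apply: contraNneq zNR => <-.
rewrite (pmulr_lge0 _ (norm_gt0 p pR)) (pmulr_lgt0 _ (norm_gt0 q qR)).
by rewrite subr_ge0 subr_gt0 => /le_lt_trans; apply.
Qed.

Lemma real_cubic_real_root x :
  x \is Num.real -> cubic a b c x = 0 -> x = - a - z - z^*.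
Proof.
move=> xR; rewrite real_cubic_factor => /eqP; rewrite !mulf_eq0 !subr_eq0.
case/orP=> [/orP[/eqP//|]|] /eqP xE; case/negP: zNR; first by rewrite -xE.
by rewrite -[z]conjCK -xE conj_Creal.
Qed.

End RealCubic.

(** The inverse of an integer is rational, and a rational algebraic integer is an integer. *)
Lemma Cint_unit (x y : algC) : x \in Num.int -> y \in Aint -> x * y = 1 ->
  x = 1 \/ x = -1.
Proof.
move=> /intrP[m ->] yA xy.
have m0 : m%:~R != 0 :> algC.
  apply/eqP => m0; move/eqP: xy.
  by rewrite m0 mul0r eq_sym oner_eq0.
have yE : y = m%:~R^-1 by rewrite -[LHS](mulKf m0) xy mulr1.
have : y \in Num.int.
  by apply: Cint_rat_Aint => //; rewrite yE rpredV rpred_int.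
case/intrP => k yk; move: xy; rewrite yk -rmorphM /= => /eqP.
rewrite -[1](mulr1z 1) eqr_int => /eqP mk.
have /eqP : absz (m * k) = 1%N by rewrite mk.
rewrite abszM muln_eq1 => /andP[/eqP m1 _].
have [->|->] : m = 1 \/ m = -1 by lia.
  by left.
by right.
Qed.

(** * Units and their integral cubics *)

Section Units.

Variable K : fieldExtType rat.

Lemma in_OK_Aint (f : {rmorphism K -> algC}) (x : K) : in_OK x -> f x \in Aint.
Proof.
case=> p mon_p px0; apply: (@root_monic_Aint (map_poly intr p)).
- rewrite -(fmorph_root f) -map_poly_comp in px0.
  by rewrite (eq_map_poly (g := f \o intr)) // => i; rewrite /= rmorph_int.
- exact: monic_map.
- by apply/polyOverP => i; rewrite coef_map /= intr_int.
Qed.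

Lemma OK_unit_in1 (f : {rmorphism K -> algC}) (x : K) :
  OK_unit x -> x \in 1%VS -> x = 1 \/ x = -1.
Proof.
case=> [xO [y yO xy]] /vlineP[k xk].
have fxQ : f x \in Crat by rewrite xk rmorphZ_num rmorph1 mulr1 Crat_rat.
have fxZ := Cint_rat_Aint fxQ (in_OK_Aint f xO).
case: (Cint_unit fxZ (in_OK_Aint f yO)); first by rewrite -rmorphM xy rmorph1.
  by rewrite -(rmorph1 f) => /fmorph_inj; left.
by rewrite -(rmorphN1 f) => /fmorph_inj; right.
Qed.

(* For f = x^3 + a x^2 + b x + c, 8 f(p / 2) is the integer
   p^3 + 2 a p^2 + 4 b p + 8 c: the sign condition is stated at half-integers. *)
Definition sign_increasing (a b c : int) : Prop :=
  forall p q : int, p < q ->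
    0 <= cubic (2 * a) (4 * b) (8 * c) p -> 0 < cubic (2 * a) (4 * b) (8 * c) q.

(** Up to sign the coefficients are the symmetric functions of the three conjugates of x, hence
    rational algebraic integers, hence integers. The norms of x and y are - c and f(n). *)
Lemma unit_cubic (hK : complex_cubic K) (n : int) (x y : K) :
    OK_unit x -> OK_unit y -> x + y = n%:~R -> x \notin 1%VS ->
  exists a b c : int,
    [/\ cubic a%:~R b%:~R c%:~R x = 0, c = 1 \/ c = -1,
        cubic a b c n = 1 \/ cubic a b c n = -1 & sign_increasing a b c].
Proof.
case: hK => dimK [rho [tau [[rhoR tauNR] _ _ _]]] xU yU xy xN1.
have {rhoR} := rhoR ord0; have {tauNR} := tauNR ord0.
move: (rho ord0) (tau ord0) => {}rho {}tau tauNR rhoR.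
have [a [b [c fx]]] := cubic_root_rat dimK xN1.
have ratR (k : rat) : ratr k \is @Num.real algC by rewrite Creal_Crat ?Crat_rat.
have f_root (f : {rmorphism K -> algC}) :
    cubic (ratr a) (ratr b) (ratr c) (f x) = 0.
  by rewrite -!(fmorph_rat f) -cubic_morph /cubic fx rmorph0.
have zNR : tau x \isn't Num.real.
  by apply/negP => zR; apply: tauNR; apply: morph_real xN1 zR.
have factor := real_cubic_factor (ratR a) (ratR b) (ratR c) zNR (f_root tau).
have root_eq := real_cubic_real_root (ratR a) (ratR b) (ratR c) zNR (f_root tau)
  (rhoR x) (f_root rho).
set z := tau x in zNR factor root_eq; set r := rho x in root_eq.
rewrite -root_eq in factor.
have [rA zA zcA] : [/\ r \in Aint, z \in Aint & z^* \in Aint].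
  by case: xU => xO _; rewrite (Aint_aut Num.conj) !in_OK_Aint.
(* The norm over the three embeddings: its inverse, the norm of t', is an algebraic integer. Its own
   integrality is supplied later, by - c and f(n). *)
have normU t : OK_unit t -> rho t * tau t * (tau t)^* \in Num.int ->
    rho t * tau t * (tau t)^* = 1 \/ rho t * tau t * (tau t)^* = -1.
  case=> _ [t' t'O tt'] tZ.
  apply: (@Cint_unit _ (rho t' * tau t' * (tau t')^*)) => //.
    by rewrite !rpredM ?(Aint_aut Num.conj) ?in_OK_Aint.
  transitivity (rho (t * t') * tau (t * t') * (tau (t * t'))^*).
    rewrite !rmorphM /=; ring.
  by rewrite tt' !rmorph1 !mulr1.
have int_of (k : rat) : ratr k \in Aint -> exists m : int, k = m%:~R.
  move=> kA; have /intrP[m km] := Cint_rat_Aint (Crat_rat k) kA.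
  exists m; apply: (fmorph_inj (ratr : {rmorphism rat -> algC})).
  by rewrite /= km ratr_int.
have [A aE] : exists m : int, a = m%:~R.
  apply: int_of; have -> : ratr a = - (r + z + z^*) by rewrite root_eq; ring.
  by rewrite rpredN !rpredD.
have [C cE] : exists m : int, c = m%:~R.
  apply: int_of; have -> : ratr c = - (r * z * z^*).
    transitivity (cubic (ratr a) (ratr b) (ratr c) 0 : algC).
      by rewrite /cubic; ring.
    by rewrite factor; ring.
  by rewrite rpredN !rpredM.
have [B bE] : exists m : int, b = m%:~R.
  apply: int_of; have -> : ratr b = r * z + r * z^* + z * z^*.
    (* The factorization is known pointwise, so b is read off from f(1) - f(0) = 1 + a + b. *)
    pose f : algC -> algC := cubic (ratr a) (ratr b) (ratr c).
    transitivity (f 1 - f 0 - 1 - ratr a); first by rewrite /f /cubic; ring.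
    have -> : ratr a = - (r + z + z^*) by rewrite root_eq; ring.
    by rewrite /f !factor; ring.
  by rewrite !rpredD ?rpredM.
exists A, B, C; rewrite aE bE cE !ratr_int in fx factor f_root root_eq *.
have toC (m : int) :
    (cubic A B C m)%:~R = (m%:~R - r) * (m%:~R - z) * (m%:~R - z^*).
  by rewrite -factor -cubic_morph.
have unit_eq (k : int) :
    (k%:~R = 1 :> algC \/ k%:~R = -1 :> algC) -> k = 1 \/ k = -1.
  by case=> kE; [left|right]; apply: (@intr_inj algC);
    rewrite kE ?mulr1z ?mulrN1z.
split=> //.
- have : - C = 1 \/ - C = -1.
    apply: unit_eq; have normE : (- C)%:~R = r * z * z^* :> algC.
      have := toC 0; rewrite /cubic !expr0n !mulr0 !addr0 !add0r => CE.
      by rewrite rmorphN /= CE; ring.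
    by rewrite normE; apply: normU; rewrite // -/r -/z -normE intr_int.
  by case=> /eqP; rewrite eqr_oppLR ?opprK => /eqP; [right|left].
- apply: unit_eq; rewrite toC.
  have yE : y = n%:~R - x by rewrite -xy addrC addKr.
  have conjB : n%:~R - z^* = (n%:~R - z)^* by rewrite rmorphB /= rmorph_int.
  have -> : (n%:~R - r) * (n%:~R - z) * (n%:~R - z^*)
      = rho y * tau y * (tau y)^*.
    by rewrite conjB yE !rmorphB /= !rmorph_int.
  apply: normU => //.
  by rewrite yE !rmorphB /= !rmorph_int -/r -/z -toC intr_int.
- move=> p q pq.
  have scale (m : int) : (cubic (2 * A) (4 * B) (8 * C) m)%:~R
      = 8 * cubic A%:~R B%:~R C%:~R (m%:~R / 2) :> algC.
    rewrite (cubic_morph (intr : {rmorphism int -> algC})) /cubic !rmorphM /=.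
    by field.
  have intR (m : int) : m%:~R \is @Num.real algC by rewrite realz.
  rewrite -(ler0z algC) -(ltr0z algC) !scale pmulr_rge0 ?pmulr_rgt0 ?ltr0n //.
  apply: (real_cubic_sign _ _ _ zNR (f_root tau));
    rewrite ?intR ?rpredM ?rpredV ?realn //.
  by rewrite ltr_pM2r ?invr_gt0 ?ltr0n // ltr_int.
Qed.

End Units.

(** * The tribonacci field as a quotient ring *)

Section Tribonacci.

Variable K : fieldExtType rat.
Hypothesis dimK : \dim {:K} = 3.

Let h := tribonacci_poly.

Lemma size_tribonacci : size h = 4.
Proof.
have -> : h = Poly [:: -1; -1; -1; 1].
  rewrite /h /tribonacci_poly /= !cons_poly_def !rmorphN !rmorph1; ring.
by rewrite (@PolyK _ 0) //= oner_eq0.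
Qed.

Lemma monic_tribonacci : h \is monic.
Proof.
by rewrite monicE lead_coefE size_tribonacci /h /tribonacci_poly !coefE.
Qed.

(** Products in [{poly %/ h}] are reduced modulo [mk_monic h], which is h itself since h is monic
    and not constant. *)
Lemma mk_monic_tribonacci : mk_monic h = h.
Proof. by rewrite /mk_monic size_tribonacci monic_tribonacci. Qed.

Section Evaluation.

Variable w : K.
Hypotheses (wN1 : w \notin 1%VS) (w3 : w ^+ 3 = w ^+ 2 + w + 1).

Let ev (p : {poly rat}) : K := (map_poly (in_alg K) p).[w].

Definition tribonacci_eval (p : {poly %/ h}) : K := ev (p : {poly rat}).

Lemma tribonacci_eval_zmod : zmod_morphism tribonacci_eval.
Proof. by move=> p q; rewrite /tribonacci_eval /ev /= rmorphB !hornerE. Qed.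

Lemma ev_rmodp p : ev (Pdiv.Ring.rmodp p (mk_monic h)) = ev p.
Proof.
rewrite mk_monic_tribonacci.
have ev_h : ev h = 0.
  rewrite /ev /h /tribonacci_poly !rmorphB /= !map_polyXn map_polyX rmorph1.
  rewrite !hornerE w3; ring.
rewrite {2}(Pdiv.RingMonic.rdivp_eq monic_tribonacci p) /ev rmorphD rmorphM /=.
by rewrite !hornerE /= -/(ev h) ev_h mulr0 add0r.
Qed.

Lemma tribonacci_eval_monoid : monoid_morphism tribonacci_eval.
Proof.
split=> [|p q]; first by rewrite /tribonacci_eval /ev /= rmorph1 hornerE.
rewrite /tribonacci_eval poly_of_qpolyM ev_rmodp.
by rewrite /ev rmorphM hornerE.
Qed.

HB.instance Definition _ := GRing.isZmodMorphism.Build {poly %/ h} K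
  tribonacci_eval tribonacci_eval_zmod.
HB.instance Definition _ := GRing.isMonoidMorphism.Build {poly %/ h} K
  tribonacci_eval tribonacci_eval_monoid.

(** Surjective because w generates K; injective because each class is represented in degree at most
    2, where 1, w, w^2 are independent. *)
Lemma tribonacci_eval_bij : bijective tribonacci_eval.
Proof.
have ex_p y : exists p : {poly rat}, ev p == y.
  have : y \in <<1%AS; w>>%VS by rewrite adjoin_cubic ?memvf.
  move/Fadjoin_poly_eq => yE.
  have /polyOver1P[p Dp] := Fadjoin_polyOver 1%AS w y.
  by exists p; rewrite /ev -Dp yE.
pose inv y := in_qpoly h (xchoose (ex_p y)).
have invK : cancel inv tribonacci_eval.
  move=> y; rewrite /tribonacci_eval /= ev_rmodp.
  exact/eqP/(xchooseP (ex_p y)).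
have ev_inj : injective tribonacci_eval.
  apply: raddf_inj => q q0; apply: val_inj.
  apply: cubic_free_poly wN1 _ q0 => //.
  rewrite -ltnS; apply: leq_trans (size_mk_monic q) _.
  by rewrite mk_monic_tribonacci size_tribonacci.
by exists inv => // p; apply: ev_inj; rewrite invK.
Qed.

Lemma is_tribonacci_field_root : is_tribonacci_field w.
Proof.
exists (tribonacci_eval : {rmorphism {poly %/ h} -> K}).
split; first exact: tribonacci_eval_bij.
rewrite /= /tribonacci_eval qpolyXE ?size_tribonacci ?monic_tribonacci //.
by rewrite /ev map_polyX hornerX.
Qed.

End Evaluation.

Lemma is_tribonacci_fieldP (w : K) : is_tribonacci_field w ->
  w \notin 1%VS /\ w ^+ 3 = w ^+ 2 + w + 1.
Proof.
case=> phi [phi_bij ->]; split.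
  (* If w were rational, injectivity of [phi] would equate the class of X, of size 2, with a
     constant, of size at most 1. *)
  apply/negP => /vlineP[q]; rewrite alg_num_field.
  rewrite -(fmorph_eq_rat (phi \o qpolyC h)) /= => /(bij_inj phi_bij).
  move/(congr1 (fun p : {poly %/ h} => size (p : {poly rat}))).
  rewrite qpolyXE ?size_tribonacci ?monic_tribonacci //= size_polyX size_polyC.
  by case: eqP.
have : in_qpoly h ('X^3 - 'X^2 - 'X - 1) = 0.
  apply: val_inj; rewrite /= -/tribonacci_poly -/h mk_monic_tribonacci.
  by rewrite Pdiv.RingMonic.rmodpp ?monic_tribonacci.
move/(congr1 phi); rewrite !rmorphB !rmorphXn rmorph0 !rmorph1 -/(qpolyX h).
move=> e; apply/eqP; rewrite -subr_eq0 -{}e; apply/eqP; ring.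
Qed.

End Tribonacci.

(** * Invariants separating the three cases *)

Section Exclusivity.

Variable K : fieldExtType rat.
Hypothesis dimK : \dim {:K} = 3.

(** In a cubic field, generating K amounts to being irrational. *)
Lemma is_LP (a : int) (w : K) : is_L a w <->
  w \notin 1%VS /\ w ^+ 3 = a%:~R * w ^+ 2 + 1.
Proof.
have rootE : root (g K a) w = (w ^+ 3 == a%:~R * w ^+ 2 + 1).
  by rewrite /root /g !hornerE -addrA -opprD subr_eq0.
split=> [[/[!rootE] /eqP w3 genw]|[wN1 w3]]; last first.
  by split; [rewrite rootE w3 | apply: adjoin_cubic].
split=> //; apply/negP => w1; have := dimK.
have /Fadjoin_idP : w \in 1%AS by [].
by rewrite -genw => ->; rewrite dimv1.
Qed.

Lemma in_Gal_rmorphism (s : 'End(K)) : in_Gal s ->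
  exists f : {rmorphism K -> K}, s =1 f.
Proof.
rewrite /in_Gal kAutE => /andP[/kHom_monoid_morphism sM _].
pose sRM := GRing.isMonoidMorphism.Build K K s sM.
have sB : zmod_morphism (s : K -> K) by exact: raddfB.
pose sZM := GRing.isZmodMorphism.Build K K s sB.
pose f : {rmorphism K -> K} := HB.pack (s : K -> K) sZM sRM.
by exists f.
Qed.

(* Degeneracy and speciality are invariant under equivalence; they hold in cases
   (1) and (2) respectively, and both fail for the sporadic solutions. *)
Definition degenerate_pair (x y : K) : Prop := x + y = 0 \/ x = y.

Definition special_pair (x y : K) : Prop :=
  (x ^+ 2 * y) ^+ 2 = 1 \/ (x * y ^+ 2) ^+ 2 = 1.

Lemma degenerate_pair_equiv (x y u v : K) : equivalent (x, y) (u, v) ->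
  degenerate_pair x y <-> degenerate_pair u v.
Proof.
case=> e [s [/in_Gal_rmorphism[f sE]]]; rewrite /= !sE.
have fI := fmorph_inj f.
have sgK : injective (fun t : K => (-1) ^+ e * t).
  by apply: mulfI; rewrite signr_eq0.
have D0 t t' : ((-1) ^+ e * f t + (-1) ^+ e * f t' = 0) <-> (t + t' = 0).
  rewrite -mulrDr -rmorphD; split=> [/eqP|->]; last by rewrite rmorph0 mulr0.
  by rewrite mulf_eq0 signr_eq0 fmorph_eq0 => /eqP.
have E t t' : ((-1) ^+ e * f t = (-1) ^+ e * f t') <-> t = t'.
  by split=> [/sgK/fI|->].
rewrite /degenerate_pair; case=> [] [-> ->]; rewrite D0 E //.
by rewrite addrC; split; case=> [|->]; [left|right|left|right].
Qed.

Lemma special_pair_equiv (x y u v : K) : equivalent (x, y) (u, v) ->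
  special_pair x y <-> special_pair u v.
Proof.
case=> e [s [/in_Gal_rmorphism[f sE]]]; rewrite /= !sE.
(* The sign enters with exponent 6 and disappears; this is the purpose of the outer squares in
   [special_pair]. *)
have E t t' : (((-1) ^+ e * f t) ^+ 2 * ((-1) ^+ e * f t')) ^+ 2
    = f ((t ^+ 2 * t') ^+ 2).
  have sg2 : ((-1) ^+ e) ^+ 2 = 1 :> K by rewrite sqrr_sign.
  transitivity ((((-1) ^+ e) ^+ 2) ^+ 3 * (f t ^+ 2 * f t') ^+ 2).
    by move: ((-1) ^+ e) => c; ring.
  by rewrite sg2 expr1n mul1r !(rmorphXn, rmorphM).
have f1 t : f t = 1 <-> t = 1.
  by split=> [|->]; rewrite ?rmorph1 // -[X in _ = X](rmorph1 f) => /fmorph_inj.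
rewrite /special_pair.
case=> [] [-> ->]; rewrite !(mulrC (_ * f _) (_ ^+ 2)) !E !f1.
  by rewrite (mulrC u).
by rewrite (mulrC u) or_comm.
Qed.

Definition regular_pair (x y : K) : Prop :=
  ~ degenerate_pair x y /\ ~ special_pair x y.

(** A square root of 1 is 1 or -1, whereas t has a nonzero coordinate along w or w^2. *)
Lemma cubic_sqr_eq1F (w t : K) (a b c : int) : w \notin 1%VS ->
  t = a%:~R * w ^+ 2 + b%:~R * w + c%:~R -> (a != 0) || (b != 0) ->
  t ^+ 2 <> 1.
Proof.
move=> wN1 tE ab0 /eqP; rewrite sqrf_eq1.
have tF (k : int) : t <> k%:~R.
  move=> tk; have [] := @cubic_free_int K dimK w a b (c - k) wN1.
    by rewrite rmorphB /= -tk tE; ring.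
  by move=> a0 b0; rewrite a0 b0 in ab0.
by case/orP=> /eqP tk; [apply: (tF 1)|apply: (tF (-1))]; rewrite tk.
Qed.

(** Reduces regularity to computing coordinates in the basis w^2, w, 1. *)
Lemma regular_pairP (w x y : K) (a b c a' b' c' n : int) : w \notin 1%VS ->
  (a != 0) || (b != 0) -> (a' != 0) || (b' != 0) -> n != 0 -> x + y = n%:~R ->
  x ^+ 2 * y = a%:~R * w ^+ 2 + b%:~R * w + c%:~R ->
  x * y ^+ 2 = a'%:~R * w ^+ 2 + b'%:~R * w + c'%:~R -> regular_pair x y.
Proof.
move=> wN1 ab ab' n0 xy xxy xyy; split; last first.
  by case; apply: cubic_sqr_eq1F; eassumption.
case=> [xy0|x_eq_y].
  have [] := @cubic_free_int K dimK w 0 0 n wN1; first by rewrite -xy xy0; ring.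
  by move=> _ _ nE; rewrite nE in n0.
(* If x = y, then n = 2 x and n^3 = 8 x^2 y, which forces a = b = 0. *)
have [] := @cubic_free_int K dimK w (8 * a) (8 * b) (8 * c - n ^+ 3) wN1.
  have -> : (8 * a)%:~R * w ^+ 2 + (8 * b)%:~R * w + (8 * c - n ^+ 3)%:~R
     = 8 * (a%:~R * w ^+ 2 + b%:~R * w + c%:~R) - n%:~R ^+ 3 :> K by ring.
  by rewrite -xxy -xy x_eq_y; ring.
lia.
Qed.

Lemma sporadic_regular (w : K) t : [\/ is_L (-1) w /\ t \in sporadic_Lm1 w,
    is_L 1 w /\ t \in sporadic_L1 w |
    is_tribonacci_field w /\ t \in sporadic_tribonacci w] ->
  regular_pair t.1.1 t.1.2.
Proof.
case=> [[/is_LP[wN1 w3]]|[/is_LP[wN1 w3]]|[/is_tribonacci_fieldP[wN1 w3]]];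
  rewrite !inE -?orbA; repeat (case/predU1P=> [->|]); try move/eqP=> ->.
(* The numerals are the coordinates along w^2, w, 1 of x^2 y, then those of x y^2, and finally n. *)
- by apply: (@regular_pairP w _ _ 2 0 (-1) (-3) 1 1 1 wN1) => //=; ring: w3.
- by apply: (@regular_pairP w _ _ 2 0 (-1) (-2) (-1) 2 1 wN1) => //=; ring: w3.
- by apply: (@regular_pairP w _ _ (-1) 0 0 2 0 (-1) 1 wN1) => //=; ring: w3.
- by apply: (@regular_pairP w _ _ 1 2 2 (-2) (-4) (-3) 1 wN1) => //=; ring: w3.
- by apply: (@regular_pairP w _ _ (-16) (-28) (-21) 12 21 16 1 wN1) => //=;
    ring: w3.
- by apply: (@regular_pairP w _ _ 0 1 0 (-2) (-1) 2 2 wN1) => //=; ring: w3.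
- by apply: (@regular_pairP w _ _ 0 (-1) (-1) 0 (-1) 1 2 wN1) => //=; ring: w3.
- by apply: (@regular_pairP w _ _ 0 (-1) 0 0 4 (-3) 3 wN1) => //=; ring: w3.
- by apply: (@regular_pairP w _ _ (-1) (-1) 0 (-3) (-3) 4 4 wN1) => //=;
    ring: w3.
- by apply: (@regular_pairP w _ _ 4 2 3 (-6) (-3) (-4) 1 wN1) => //=; ring: w3.
- by apply: (@regular_pairP w _ _ 1 0 (-2) 0 (-2) 3 1 wN1) => //=; ring: w3.
- by apply: (@regular_pairP w _ _ (-1) 1 0 3 (-3) (-2) 2 wN1) => //=; ring: w3.
- by apply: (@regular_pairP w _ _ 0 (-1) 0 0 (-2) 3 3 wN1) => //=; ring: w3.
- by apply: (@regular_pairP w _ _ 1 (-1) (-1) (-3) 5 1 2 wN1) => //=; ring: w3.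
Qed.

End Exclusivity.

(** * Integer cubics with the sign property *)

Lemma sign_increasing_int (a b c p q : int) : sign_increasing a b c -> p < q ->
  0 <= cubic a b c p -> 0 < cubic a b c q.
Proof.
move=> sgn pq; have := sgn (2 * p) (2 * q); rewrite /cubic; lia.
Qed.

(* The triples (n, a, b) other than (n, -n, 0) for which f = x^3 + a x^2 + b x - 1
   can be sign increasing with f(n) = 1 or -1. The first ten have f(n) = f(0), so
   that f = x (x - n) (x - m) - 1: a gap at least 2 below the middle one of the
   roots 0, n, m, or a large gap above it, would make f nonnegative before a
   point where it is -1. The others have f(n) = - f(0), which forces n to
   divide 2. *)
Definition exceptional_cubics : seq (int * int * int) :=
  [:: (1, -2, 1);
      (1, -3, 2); (2, -3, 2); (1, 0, -1);
      (1, -4, 3); (3, -4, 3); (2, -1, -2);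
      (1, -5, 4); (4, -5, 4); (3, -2, -3);
      (1, -4, 5); (1, -3, 4); (1, -2, 3); (1, -1, 2); (1, 0, 1); (1, 1, 0);
      (2, -5, 7); (2, -4, 5); (2, -3, 3); (2, -2, 1); (2, -1, -1)].

Lemma exceptional_cubicsP (n a b : int) : 0 < n ->
    cubic a b (-1) n = 1 \/ cubic a b (-1) n = -1 ->
    sign_increasing a b (-1) ->
  (a = - n /\ b = 0) \/ (n, a, b) \in exceptional_cubics.
Proof.
move=> n_gt0 fn sgn.
have sgnZ p q := @sign_increasing_int a b (-1) p q sgn.
(* When f(n) = 1, f(n) + 1 = n (n^2 + a n + b) = 2, so n divides 2. *)
have [fn1|fn1] := fn.
  have n12 : n = 1 \/ n = 2.
    have : n * (n ^+ 2 + a * n + b) = 2 by move: fn1; rewrite /cubic; lia.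
    move: (n ^+ 2 + _ + b) => k nk.
    have k_gt0 : 0 < k by rewrite -(pmulr_rgt0 _ n_gt0) nk.
    have : n <= n * k by rewrite ler_peMr; lia.
    lia.
  (* From f(0) = -1 follows f(-1) < 0, which bounds a above; from f(n) = 1 follows f(n + 1) > 0,
     which bounds a below. *)
  right; have := sgnZ (-1) 0 isT; have := sgnZ 1 2 isT; have := sgnZ 2 3 isT.
  case: n12 fn1 => ->; rewrite /cubic => fn1 s23 s12 s01.
    have -> : b = 1 - a by lia.
    have cases : a = -4 \/ a = -3 \/ a = -2 \/ a = -1
      \/ a = 0 \/ a = 1 by lia.
    by case: cases => [->|[->|[->|[->|[->|->]]]]]; vm_compute.
  have -> : b = - (3 + 2 * a) by lia.
  have cases : a = -5 \/ a = -4 \/ a = -3 \/ a = -2 \/ a = -1 by lia.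
  by case: cases => [->|[->|[->|[->|->]]]]; vm_compute.
(* Now f(n) = f(0) = -1, and m is the third root of f + 1. *)
have [m aE] : exists m, a = - (n + m) by exists (- n - a); lia.
have bE : b = n * m.
  apply: (mulfI (lt0r_neq0 n_gt0)); move: fn1; rewrite /cubic aE => fn1.
  by apply/eqP; rewrite -subr_eq0; apply/eqP; lia.
have fE p : cubic a b (-1) p = p * (p - n) * (p - m) - 1.
  by rewrite aE bE /cubic; ring.
have hE p : cubic (2 * a) (4 * b) (8 * -1) p
    = p * (p - 2 * n) * (p - 2 * m) - 8.
  by rewrite aE bE /cubic; ring.
have [m_lt0|m_gt0|m0] := ltgtP m 0;
  last by left; rewrite bE m0 mulr0; split; lia.
  (* If m < -1, then f(m + 1) >= 0 although f(0) = -1. *)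
  have mE : m = -1.
    have [|m_lt] := leP (-1) m; first lia.
    have := sgnZ (m + 1) 0; rewrite !fE; nia.
  (* The value 8 f(-1/2) = 2 n - 7 has to be negative. *)
  right; have := sgn (-1) 0 isT; rewrite !hE aE bE mE => n_le3.
  have cases : n = 1 \/ n = 2 \/ n = 3 by lia.
  by case: cases => [->|[->|->]]; vm_compute.
right; rewrite aE bE; have [mn|mn|mn] := ltgtP m n.
(* If m > 1, then f(1) >= 0 although f(m) = -1. Once m = 1, negativity of 8 f(1/2) = 2 n - 9 bounds
   n. The next branch exchanges n and m. *)
- have mE : m = 1.
    have [|m_gt1] := leP m 1; first lia.
    have := sgnZ 1 m; rewrite !fE; nia.
  have := sgn 1 2 isT; rewrite !hE mE => n_le4.
  have cases : n = 2 \/ n = 3 \/ n = 4 by lia.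
  by case: cases => [->|[->|->]]; vm_compute.
- have nE : n = 1.
    have [|n_gt1] := leP n 1; first lia.
    have := sgnZ 1 n; rewrite !fE; nia.
  have := sgn 1 2 isT; rewrite !hE nE => m_le4.
  have cases : m = 2 \/ m = 3 \/ m = 4 by lia.
  by case: cases => [->|[->|->]]; vm_compute.
(* With a double root at n > 1, f(n - 1) = n - 2 >= 0 although f(n) = -1. *)
have nE : n = 1.
  have [|n_gt1] := leP n 1; first lia.
  have := sgnZ (n - 1) n; rewrite !fE mn; nia.
by rewrite mn nE; vm_compute.
Qed.

(** * Classification up to the two symmetries *)

Section Classification.

Variable K : fieldExtType rat.
Hypothesis dimK : \dim {:K} = 3.

Definition unit_sum_cubic (n : int) (x : K) (a b c : int) : Prop :=
  [/\ x \notin 1%VS, cubic a%:~R b%:~R c%:~R x = 0, c = 1 \/ c = -1,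
      cubic a b c n = 1 \/ cubic a b c n = -1 & sign_increasing a b c].

(** The cubic of - x is - f(- X); reversing both order and sign preserves the sign condition. *)
Lemma unit_sum_cubicN n x a b c :
  unit_sum_cubic n x a b c -> unit_sum_cubic (- n) (- x) (- a) b (- c).
Proof.
case=> xN1 fx c1 fn sgn; have oddE (R : comNzRingType) (t u v y : R) :
    cubic (- t) u (- v) (- y) = - cubic t u v y by rewrite /cubic; ring.
split; first by rewrite rpredN.
- by rewrite !rmorphN oddE fx oppr0.
- lia.
- by rewrite oddE; case: fn => ->; [right|left]; rewrite ?opprK.
move=> p q pq; have := sgn (- q) (- p); rewrite /cubic; lia.
Qed.

(** The cubic of n - x is - f(n - X), which exchanges the values at 0 and n up to sign. *)
Lemma unit_sum_cubic_swap n x a b c : unit_sum_cubic n x a b c ->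
  unit_sum_cubic n (n%:~R - x) (- (3 * n + a)) (3 * n ^+ 2 + 2 * a * n + b)
                 (- cubic a b c n).
Proof.
case=> xN1 fx c1 fn sgn; have swapE (R : comNzRingType) (m t u v y : R) :
    cubic (- (3 * m + t)) (3 * m ^+ 2 + 2 * t * m + u) (- cubic t u v m) (m - y)
    = - cubic t u v y by rewrite /cubic; ring.
split.
- apply: contra xN1 => nx1.
  have -> : x = n%:~R - (n%:~R - x) by ring.
  by rewrite rpredB // rpred_int.
- transitivity (- cubic a%:~R b%:~R c%:~R x); last by rewrite fx oppr0.
  by rewrite -(swapE _ n%:~R) /cubic; ring.
- lia.
- have := swapE int n a b c 0; rewrite subr0 => ->.
  by rewrite /cubic !expr0n !mulr0 !add0r; case: c1 => ->; [right|left].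
move=> p q pq; have := sgn (2 * n - q) (2 * n - p); rewrite /cubic; lia.
Qed.

Lemma in_Gal1 : in_Gal (\1%VF : 'End(K)).
Proof. by rewrite /in_Gal kAutE kHom1 /= lim1g. Qed.

Lemma equivalent_refl (p : K * K) : equivalent p p.
Proof.
exists false, \1%VF; split; first exact: in_Gal1.
by left; rewrite !lfunE !mul1r -surjective_pairing.
Qed.

Lemma equivalent_swapl (x y : K) p : equivalent (x, y) p -> equivalent (y, x) p.
Proof.
by case=> e [s [sG [] [-> ->]]]; exists e, s; split=> //; [right|left].
Qed.

Lemma equivalentNl (x y : K) p : equivalent (x, y) p -> equivalent (- x, - y) p.
Proof.
case=> e [s [sG xyE]]; exists (~~ e), s; split=> //.
by case: xyE => [] [-> ->]; [left|right]; rewrite signrN !mulNr.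
Qed.

Definition sporadic_or_family (n : int) (x y : K) : Prop :=
  case2 n x y \/ case3 x y.

Lemma sporadic_or_family_equiv n m (x y x' y' : K) :
    m = n \/ m = - n ->
    (forall p, equivalent (x, y) p -> equivalent (x', y') p) ->
  sporadic_or_family n x y -> sporadic_or_family m x' y'.
Proof.
move=> mn imp [[a [w [a0 a1 aL na xyE]]]|[w xyE]]; [left|right].
  exists a, w; split=> //; first lia.
  (* The last clause of [case2] unfolds to an equivalence with (w, - w + a). *)
  by have /imp := xyE : equivalent (x, y) (w, - w + a%:~R).
exists w; case: xyE => [] [wL [t tS tE]].
- by constructor 1; split=> //; exists t => //; apply: imp.
- by constructor 2; split=> //; exists t => //; apply: imp.
- by constructor 3; split=> //; exists t => //; apply: imp.
Qed.

Lemma notin1_poly (x w : K) (a b c : int) : x \notin 1%VS ->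
  x = a%:~R * w ^+ 2 + b%:~R * w + c%:~R -> w \notin 1%VS.
Proof.
move=> xN1 xE; apply: contra xN1 => w1.
have w1A : w \in 1%AS by [].
by rewrite xE -[1%VS]/(1%AS : {vspace K}) !rpredD ?rpredM ?rpredX ?rpred_int.
Qed.

(** Here k is a position in the sporadic list; expressing x through w shows that w is irrational
    too. *)
Lemma case3_Lm1 (x y w : K) (k : nat) (a b c : int) : x \notin 1%VS ->
  x = a%:~R * w ^+ 2 + b%:~R * w + c%:~R -> w ^+ 3 = - w ^+ 2 + 1 ->
  let t := nth (0, 0, 0) (sporadic_Lm1 w) k in
  (k < size (sporadic_Lm1 w))%N ->
  (x, y) = t.1 \/ (y, x) = t.1 -> case3 x y.
Proof.
move=> xN1 xE w3 t kS tE; have wN1 := notin1_poly xN1 xE.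
exists w; constructor 1; split.
  by apply/(is_LP dimK); split=> //; rewrite w3; ring.
exists t; first exact: mem_nth.
by case: tE => <-; [|apply: equivalent_swapl]; apply: equivalent_refl.
Qed.

Lemma case3_L1 (x y w : K) (k : nat) (a b c : int) : x \notin 1%VS ->
  x = a%:~R * w ^+ 2 + b%:~R * w + c%:~R -> w ^+ 3 = w ^+ 2 + 1 ->
  let t := nth (0, 0, 0) (sporadic_L1 w) k in
  (k < size (sporadic_L1 w))%N ->
  (x, y) = t.1 \/ (y, x) = t.1 -> case3 x y.
Proof.
move=> xN1 xE w3 t kS tE; have wN1 := notin1_poly xN1 xE.
exists w; constructor 2; split.
  by apply/(is_LP dimK); split=> //; rewrite w3; ring.
exists t; first exact: mem_nth.
by case: tE => <-; [|apply: equivalent_swapl]; apply: equivalent_refl.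
Qed.

Lemma case3_tribonacci (x y w : K) (k : nat) (a b c : int) : x \notin 1%VS ->
  x = a%:~R * w ^+ 2 + b%:~R * w + c%:~R -> w ^+ 3 = w ^+ 2 + w + 1 ->
  let t := nth (0, 0, 0) (sporadic_tribonacci w) k in
  (k < size (sporadic_tribonacci w))%N ->
  (x, y) = t.1 \/ (y, x) = t.1 -> case3 x y.
Proof.
move=> xN1 xE w3 t kS tE; have wN1 := notin1_poly xN1 xE.
exists w; constructor 3; split.
  exact: is_tribonacci_field_root.
exists t; first exact: mem_nth.
by case: tE => <-; [|apply: equivalent_swapl]; apply: equivalent_refl.
Qed.

Lemma unit_sum_cubic_exceptional (n a b : int) (x : K) :
    (n, a, b) \in exceptional_cubics -> x \notin 1%VS ->
    cubic a%:~R b%:~R (-1) x = 0 ->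
  sporadic_or_family n x (n%:~R - x).
Proof.
move=> exc xN1 fx.
have x3 : x ^+ 3 = - a%:~R * x ^+ 2 - b%:~R * x + 1.
  by apply/eqP; rewrite -subr_eq0 -[X in _ == X]fx /cubic; apply/eqP; ring.
move: exc; rewrite !inE; do 20? [case/predU1P=> [[? ? ?]|]];
  last move/eqP=> [? ? ?]; subst n a b.
(* The one exceptional cubic in the family of case (2): w = x - 1 is a root of g_a for a = -1, with
   n = - a. *)
- left; exists (-1), (x - 1); split=> //; [|by right|].
    apply/(is_LP dimK); split; last by ring: x3.
    by apply: (@notin1_poly x _ 0 1 1) => //; ring.
  apply: (@equivalent_swapl _ _ (x - 1, - (x - 1) + (-1)%:~R)).
  have -> : (1%:~R - x, x) = (- (x - 1), - (- (x - 1) + (-1)%:~R)).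
    by congr (_, _); ring.
  exact/equivalentNl/equivalent_refl.
(* In these calls w is obtained by inverting the sporadic expression of x, whose coordinates along
   w^2, w, 1 follow the list position. *)
- by right; apply: (@case3_Lm1 x _ (x ^+ 2 - 2 * x) 3 1 1 1 xN1) => //=;
    [ring: x3 | ring: x3 | right; congr (_, _); ring: x3].
- by right; apply: (@case3_Lm1 x _ (x ^+ 2 - 2 * x) 6 1 1 1 xN1) => //=;
    [ring: x3 | ring: x3 | left; congr (_, _); ring: x3].
- by right; apply: (@case3_Lm1 x _ (x ^+ 2 - 1) 2 1 1 0 xN1) => //=;
    [ring: x3 | ring: x3 | left; congr (_, _); ring: x3].
- by right; apply: (@case3_L1 x _ (x ^+ 2 - 3 * x + 1) 0 1 0 1 xN1) => //=;
    [ring: x3 | ring: x3 | right; congr (_, _); ring: x3].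
- by right; apply: (@case3_L1 x _ (x ^+ 2 - 3 * x + 1) 3 1 0 1 xN1) => //=;
    [ring: x3 | ring: x3 | left; congr (_, _); ring: x3].
- by right; apply: (@case3_L1 x _ (x ^+ 2 - x - 1) 2 1 0 0 xN1) => //=;
    [ring: x3 | ring: x3 | left; congr (_, _); ring: x3].
- by right; apply: (@case3_Lm1 x _ (- x ^+ 2 + 5 * x - 3) 4 1 2 2 xN1) => //=;
    [ring: x3 | ring: x3 | left; congr (_, _); ring: x3].
- by right; apply: (@case3_Lm1 x _ (- x ^+ 2 + 5 * x - 3) 8 1 2 2 xN1) => //=;
    [ring: x3 | ring: x3 | left; congr (_, _); ring: x3].
- by right; apply: (@case3_Lm1 x _ (- x ^+ 2 + 3 * x + 1) 7 1 2 1 xN1) => //=;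
    [ring: x3 | ring: x3 | left; congr (_, _); ring: x3].
- by right; apply: (@case3_Lm1 x _ (- x + 1) 0 0 (-1) 1 xN1) => //=;
    [ring: x3 | ring: x3 | right; congr (_, _); ring: x3].
- by right; apply: (@case3_L1 x _ (x ^+ 2 - 2 * x + 2) 1 (-1) 1 1 xN1) => //=;
    [ring: x3 | ring: x3 | right; congr (_, _); ring: x3].
- by right; apply: (@case3_Lm1 x _ (x ^+ 2 - x + 1) 1 (-1) 0 1 xN1) => //=;
    [ring: x3 | ring: x3 | right; congr (_, _); ring: x3].
- by right; apply: (@case3_Lm1 x _ (x ^+ 2 - x + 1) 1 1 0 0 xN1) => //=;
    [ring: x3 | ring: x3 | left; congr (_, _); ring: x3].
- by right; apply: (@case3_L1 x _ (x ^+ 2 + 1) 1 1 (-1) 0 xN1) => //=;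
    [ring: x3 | ring: x3 | left; congr (_, _); ring: x3].
- by right; apply: (@case3_Lm1 x _ (x) 0 0 1 0 xN1) => //=;
    [ring: x3 | ring: x3 | left; congr (_, _); ring: x3].
- by right; apply: (@case3_tribonacci x _ (- x + 2) 0 0 (-1) 2 xN1) => //=;
    [ring: x3 | ring: x3 | right; congr (_, _); ring: x3].
- by right; apply: (@case3_Lm1 x _ (- x + 1) 5 0 (-1) 1 xN1) => //=;
    [ring: x3 | ring: x3 | right; congr (_, _); ring: x3].
(* The triple (2, -3, 3) gives the cube of X - 1, excluded by irrationality of x. *)
- have /eqP : (x - 1) ^+ 3 = 0 by ring: x3.
  by rewrite expf_eq0 subr_eq0 /= => /eqP x1; case/negP: xN1; rewrite x1 rpred1.
- by right; apply: (@case3_Lm1 x _ (x - 1) 5 0 1 1 xN1) => //=;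
    [ring: x3 | ring: x3 | left; congr (_, _); ring: x3].
- by right; apply: (@case3_tribonacci x _ (x) 0 0 1 0 xN1) => //=;
    [ring: x3 | ring: x3 | left; congr (_, _); ring: x3].
Qed.

Lemma unit_sum_cubic_classification n x a b c : n != 0 ->
  unit_sum_cubic n x a b c -> sporadic_or_family n x (n%:~R - x).
Proof.
wlog n_gt0 : n x a b c / 0 < n => [hwlog n0 H|_].
  have [n_lt0|n_gt0|n_eq0] := ltgtP n 0; last by rewrite n_eq0 in n0.
    have := hwlog (- n) (- x) (- a) b (- c).
    rewrite oppr_gt0 oppr_eq0 => /(_ n_lt0 n0 (unit_sum_cubicN H)).
    apply: sporadic_or_family_equiv; first by right; rewrite opprK.
    by move=> p /equivalentNl; rewrite rmorphN !opprK opprD opprK.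
  exact: hwlog n_gt0 n0 H.
wlog c1 : x a b c / c = -1 => [hwlog H|].
  have [_ _ [c1|c1] fn sgn] := H; last exact: hwlog c1 H.
  (* As f(0) = 1 and n > 0, f(n) is positive; swapping then makes the constant term - f(n) = -1. *)
  have fn1 : cubic a b c n = 1.
    case: fn => // fn; have := @sign_increasing_int _ _ _ 0 n sgn n_gt0.
    by rewrite fn /cubic; lia.
  have /hwlog := unit_sum_cubic_swap H; rewrite fn1 => /(_ erefl).
  apply: sporadic_or_family_equiv; first by left.
  by move=> p /equivalent_swapl; rewrite opprB addrC subrK.
rewrite c1 => -[xN1 fx _ fn sgn].
have [[aE bE]|exc] := exceptional_cubicsP n_gt0 fn sgn; last first.
  by apply: unit_sum_cubic_exceptional exc xN1 _; rewrite -[RHS]fx rmorphN1.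
left; exists n, x; split=> //; [lia | lia | | by left | ].
  apply/(is_LP dimK); split=> //; apply/eqP; rewrite -subr_eq0 -[X in _ == X]fx.
  by rewrite aE bE /cubic; apply/eqP; ring.
rewrite addrC; exact: equivalent_refl.
Qed.

End Classification.

(** * Exclusivity and conclusion *)

Lemma case1_degenerate (K : fieldExtType rat) (n : int) (x y : K) :
  x + y = n%:~R -> case1 n x y -> degenerate_pair x y.
Proof.
by move=> xy [n0|[-> ->]|[-> ->]]; [left; rewrite xy n0 | right | right].
Qed.

(** The equation g_a(w) = 0 reads w^2 (a - w) = -1; moreover w + (a - w) = a is nonzero and 2 w = a
    would make w rational. *)
Lemma case2_special (K : fieldExtType rat) (n : int) (x y : K) :
  \dim {:K} = 3 -> case2 n x y -> special_pair x y /\ ~ degenerate_pair x y.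
Proof.
move=> dimK [a [w [a0 _ /(is_LP dimK)[wN1 w3] _ xyE]]].
have {}xyE : equivalent (x, y) (w, - w + a%:~R) by [].
rewrite (special_pair_equiv xyE) (degenerate_pair_equiv xyE); split.
  left; suff -> : w ^+ 2 * (- w + a%:~R) = -1 by rewrite sqrrN expr1n.
  by transitivity (a%:~R * w ^+ 2 - w ^+ 3); [ring | rewrite w3; ring].
case=> [wa0|wa].
  have [] := @cubic_free_int K dimK w 0 0 a wN1; last by move=> _ _ /a0.
  by rewrite -[RHS]wa0; ring.
have [] := @cubic_free_int K dimK w 0 2 (- a) wN1; last by [].
by transitivity (w - (- w + a%:~R)); [ring | rewrite -wa subrr].
Qed.

Lemma case3_regular (K : fieldExtType rat) (x y : K) :
  \dim {:K} = 3 -> case3 x y -> regular_pair x y.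
Proof.
move=> dimK [w H].
have [[[u v] m] /= uv xyE] : exists2 t : K * K * int,
    regular_pair t.1.1 t.1.2 & equivalent (x, y) t.1.
  case: H => [] [wL [t tS tE]]; exists t => //;
    apply: (sporadic_regular dimK (w := w)).
  - by constructor 1.
  - by constructor 2.
  - by constructor 3.
by rewrite /regular_pair (special_pair_equiv xyE) (degenerate_pair_equiv xyE).
Qed.

Theorem theorem1p3 (K : fieldExtType rat) (n : int) (eps del : K)
    (hK : complex_cubic K) (heps : OK_unit eps) (hdel : OK_unit del)
    (hsum : eps + del = n%:~R) :
  exactly_one (case1 n eps del) (case2 n eps del) (case3 eps del).
Proof.
have dimK : \dim {:K} = 3 by case: hK.
have c1 := case1_degenerate hsum.
have c2 : case2 n eps del -> _ := case2_special dimK.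
have c3 : case3 eps del -> _ := case3_regular dimK.
have [|[]] : case1 n eps del \/ sporadic_or_family n eps del.
- have delE : del = n%:~R - eps by rewrite -hsum addrC addKr.
  have [n0|n0] := eqVneq n 0; first by left; constructor 1.
  (* If eps is rational, so is del, and both are 1 or -1; opposite signs give n = 0. *)
  have [eps1|epsN1] := boolP (eps \in 1%VS).
    have [_ [rho _]] := hK.
    have del1 : del \in 1%VS by rewrite delE rpredB // rpred_int.
    have opp_sum0 : eps + del = 0 -> n = 0.
      rewrite hsum -(rmorph_int (in_alg K)) => /eqP.
      by rewrite fmorph_eq0 intr_eq0 => /eqP.
    left; have [epsE|epsE] := OK_unit_in1 (rho ord0) heps eps1;
      have [delE1|delE1] := OK_unit_in1 (rho ord0) hdel del1;
      rewrite epsE delE1.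
    + by constructor 2.
    + by constructor 1; apply: opp_sum0; rewrite epsE delE1 subrr.
    + by constructor 1; apply: opp_sum0; rewrite epsE delE1 addNr.
    + by constructor 3.
  have [a [b [c [fx c_unit fn sgn]]]] := unit_cubic hK heps hdel hsum epsN1.
  right; rewrite delE.
  by apply: (@unit_sum_cubic_classification K dimK n eps a b c).
- move=> H1; constructor 1; split=> // [/c2[_]|/c3[+ _]]; apply; exact: c1.
- move=> H2; constructor 2; split=> // [/c1|/c3[_]]; first by have [] := c2 H2.
  by apply; have [] := c2 H2.
move=> H3; have [nd ns] := c3 H3; constructor 3; split=> // [/c1//|/c2[]//].
Qed.
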